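(* Let $s,\ell$ be positive integers with $s\le\ell$, let $\tau=\deg_{\mathcal{H}}\Lambda_s$, and suppose $\tau+\ell m_{\mathrm H}<sn$ and $$\tau>\tau_{\max}:=sn\Big(1-\frac{sC_{<s}-W_{<s}}{sC_{\le\ell}}\Big)-\frac{h}{h+1}\ell m_{\mathrm H}+\Big(\frac{1}{C_{\le\ell}}-1\Big)+g.$$ Then Problem 1 (with parameters $s,\ell$) has at least two solutions of degree $\tau$.
   Context: Let $q$ be a prime power; the Hermitian curve over $\mathbb{F}_{q^2}$ has affine equation $Y^q+Y=X^{q+1}$, genus $g=\tfrac12q(q-1)$, affine rational points $P_1,\dots,P_n$ ($n=q^3$) and point at infinity $P_\infty$. $\mathcal{R}=\bigcup_{m\ge0}\mathcal{L}(mP_\infty)=\mathbb{F}_{q^2}[X,Y]/(Y^q+Y-X^{q+1})$ with basis $\{X^iY^j:i\ge0,0\le j<q\}$; $\deg_{\mathcal{H}}f=-v_{P_\infty}(f)$, so $\deg_{\mathcal{H}}(X^iY^j)=iq+j(q+1)$; $f\ne0$ is monic if the coefficient of its basis monomial of largest $\deg_{\mathcal{H}}$ is $1$. Fix integers $h\ge1$, $m_{\mathrm H}$ with $2(g-1)<m_{\mathrm H}<n$. Let $\mathbf{f}\in\mathcal{L}(m_{\mathrm H}P_\infty)^h$, $\mathbf{r}=\mathbf{c}+\mathbf{e}\in\mathbb{F}_{q^2}^{h\times n}$ with $\mathbf{c}$ having $i$-th row $(f_i(P_1),\dots,f_i(P_n))$, $\mathcal{E}$ the set of indices of nonzero columns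 of $\mathbf{e}$; $\Lambda_s$ the unique monic element of minimal $\deg_{\mathcal{H}}$ of $\{\Lambda\in\mathcal{R}:v_{P_i}(\Lambda)\ge s\ \forall i\in\mathcal{E}\}$. $\mathbf{R}=(R_1,\dots,R_h)$, $R_i\in\mathcal{R}$, $\deg_{\mathcal{H}}R_i<n+2g$, $R_i(P_j)=r_{i,j}$; $G=X^{q^2}-X$. For $\mathbf{i},\mathbf{j}\in\mathbb{Z}_{\ge0}^h$: $|\mathbf{i}|=\sum_\mu i_\mu$, $\mathbf{i}\preceq\mathbf{j}$ componentwise, $\mathbf{a}^{\mathbf{i}}=\prod_\mu a_\mu^{i_\mu}$, $\binom{\mathbf{j}}{\mathbf{i}}=\prod_\mu\binom{j_\mu}{i_\mu}$. Problem 1: $\mathcal{I}=\{\mathbf{i}:|\mathbf{i}|<s\}$, $\mathcal{J}=\{\mathbf{j}:1\le|\mathbf{j}|\le\ell\}$, $A_{\mathbf{i},\mathbf{j}}=\binom{\mathbf{j}}{\mathbf{i}}\mathbf{R}^{\mathbf{j}-\mathbf{i}}G^{|\mathbf{i}|}$ ($=0$ if $\mathbf{i}\not\preceq\mathbf{j}$). A solution is a family $\lambda_{\mathbf{i}},\psi_{\mathbf{j}}\in\mathcal{R}$ with $\lambda_{\mathbf{0}}$ monic, $\psi_{\mathbf{j}}=\sum_{\mathbf{i}\in\mathcal{I}}\lambda_{\mathbf{i}}A_{\mathbf{i},\mathbf{j}}$ for $|\mathbf{j}|<s$, $\psi_{\mathbf{j}}\equiv\sum_{\mathbf{i}\in\mathcal{I}}\lambda_{\mathbf{i}}A_{\mathbf{i},\mathbf{j}}\bmod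 G^s$ for $|\mathbf{j}|\ge s$, $\deg_{\mathcal{H}}\lambda_{\mathbf{0}}\ge\deg_{\mathcal{H}}\lambda_{\mathbf{i}}-|\mathbf{i}|(2g-1)$ for $\mathbf{i}\in\mathcal{I}$, and $\deg_{\mathcal{H}}\lambda_{\mathbf{0}}\ge\deg_{\mathcal{H}}\psi_{\mathbf{j}}-|\mathbf{j}|m_{\mathrm H}$ for $\mathbf{j}\in\mathcal{J}$; its degree is $\deg_{\mathcal{H}}\lambda_{\mathbf{0}}$. Counting quantities (over $\mathbb{Z}_{\ge0}^h$): $C_{\le\ell}=\#\{\mathbf{j}:|\mathbf{j}|\le\ell\}$, $C_{<s}=\#\{\mathbf{i}:|\mathbf{i}|<s\}$, $W_{<s}=\sum_{|\mathbf{i}|<s}|\mathbf{i}|$. *)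

(* Defs.v *)
From HB Require Import structures.
From mathcomp Require Import all_boot all_order all_algebra.
Set Implicit Arguments. Unset Strict Implicit. Unset Printing Implicit Defensive.
Import Order.TTheory GRing.Theory Num.Theory.
Local Open Scope ring_scope.

(* Elements of R = F[X,Y]/(Y^q+Y-X^(q+1)) are represented by bivariate
   polynomials p : {poly {poly F}}: the OUTER variable is Y, the coefficients
   are polynomials in X.  p = sum_j p_j(X) Y^j. *)
Notation bipoly F := {poly {poly F}}.

Section Hermitian.
Variable F : fieldType.
Variable q : nat.

Definition hermEq : bipoly F := 'X ^+ q + 'X - (('X ^+ q.+1 : {poly F}))%:P.

(* canonical representative in the basis X^i Y^j, j < q *)
Definition redH (p : bipoly F) : bipoly F := p %% hermEq.

Definition eqR (a b : bipoly F) : Prop := exists c : bipoly F, a - b = c * hermEq.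

Definition coefH (p : bipoly F) (i j : nat) : F := (redH p)`_j`_i.

Definition rowH (p : bipoly F) (j : nat) : {poly F} := (redH p)`_j.

Definition degH (p : bipoly F) : nat :=
  \big[maxn/0%N]_(j < size (redH p))
     \big[maxn/0%N]_(i < size (rowH p j) | coefH p i j != 0) (i * q + j * q.+1)%N.

(* p = 0 in R, or deg_H p <= d  (deg_H 0 = -oo) *)
Definition degLe (p : bipoly F) (d : nat) : Prop := redH p = 0 \/ (degH p <= d)%N.

Definition monicH (p : bipoly F) : Prop :=
  exists i j : nat, (redH p)`_j`_i = 1 /\ (i * q + j * q.+1)%N = degH p.

Definition evalH (pt : F * F) (p : bipoly F) : F := (p.[pt.2%:P]).[pt.1].

(* v_P(f) >= s for the affine point P = (a,b): f lies in m_P^s, where m_P is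
   the maximal ideal of the local ring O_P = R_{M_P}, M_P = (X-a, Y-b); i.e.
   u f \in M_P^s for some u with u(P) <> 0. *)
Definition vge (pt : F * F) (s : nat) (f : bipoly F) : Prop :=
  exists u : bipoly F, evalH pt u != 0 /\
  exists (c : nat -> bipoly F) (d : bipoly F),
    u * f = \sum_(k < s.+1) c k * (('X - pt.1%:P) : {poly F})%:P ^+ k
                               * ('X - pt.2%:P%:P) ^+ (s - k) + d * hermEq.

Definition Gpoly : bipoly F := (('X ^+ (q ^ 2) - 'X : {poly F}))%:P.

Definition genus : nat := (q * (q - 1))./2.

End Hermitian.

(* Multi-indices in Z_{>=0}^h with all components <= l (every multi-index of
   total degree <= l is of this form). *)
Notation midx h l := {ffun 'I_h -> 'I_l.+1}.

Section Multi.
Variables h l : nat.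

Definition mnorm (i : midx h l) : nat := (\sum_(mu < h) (i mu : nat))%N.
Definition mle (i j : midx h l) : bool := [forall mu, (i mu <= j mu)%N].
Definition mbinom (i j : midx h l) : nat := (\prod_(mu < h) 'C(j mu, i mu))%N.
Definition mzero : midx h l := [ffun => ord0].

Definition Cle : nat := #|[set j : midx h l | (mnorm j <= l)%N]|.
Definition Clt (s : nat) : nat := #|[set i : midx h l | (mnorm i < s)%N]|.
Definition Wlt (s : nat) : nat := (\sum_(i : midx h l | (mnorm i < s)%N) mnorm i)%N.

Variable F : fieldType.
Variable q : nat.

Definition Aij (Rv : 'I_h -> bipoly F) (i j : midx h l) : bipoly F :=
  if mle i j then (mbinom i j)%:R * (\prod_(mu < h) Rv mu ^+ (j mu - i mu))
                  * Gpoly F q ^+ mnorm i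
  else 0.

Definition rowsum (s : nat) (Rv : 'I_h -> bipoly F) (lam : midx h l -> bipoly F)
  (j : midx h l) : bipoly F :=
  \sum_(i : midx h l | (mnorm i < s)%N) lam i * Aij Rv i j.

Definition isSolution (s mH : nat) (Rv : 'I_h -> bipoly F)
  (lam psi : midx h l -> bipoly F) : Prop :=
  [/\ monicH q (lam mzero),
      (forall j, (1 <= mnorm j <= l)%N -> (mnorm j < s)%N ->
          eqR q (psi j) (rowsum s Rv lam j)),
      (forall j, (1 <= mnorm j <= l)%N -> (s <= mnorm j)%N ->
          exists c : bipoly F, eqR q (psi j - rowsum s Rv lam j) (c * Gpoly F q ^+ s)),
      (forall i, (mnorm i < s)%N ->
          degLe q (lam i) (degH q (lam mzero) + mnorm i * (2 * genus q - 1))) &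
      (forall j, (1 <= mnorm j <= l)%N ->
          degLe q (psi j) (degH q (lam mzero) + mnorm j * mH))].

End Multi.

Definition tau_max (h l s n g mH : nat) : rat :=
  (s * n)%:R * (1 - ((s * Clt h l s)%:R - (Wlt h l s)%:R) / (s * Cle h l)%:R)
  - (h%:R / (h.+1)%:R) * (l * mH)%:R + (1 / (Cle h l)%:R - 1) + g%:R.

(* Main.v *)
(** A first solution is [lambda_i = Lambda_s (f - R)^i / G^|i|],
    [psi_j = Lambda_s f^j]: at every affine rational point [X - a] is a
    uniformizer and [Lambda_s (f - R)^i] vanishes there to order
    [min(s, |i|)], which makes it divisible by [G^min(s, |i|)] in the ring;
    the equations are the expansion of [f^j = (R + (f - R))^j].

    A second one differs from it by a nonzero [w] satisfying the same linear
    equations and degree bounds, whose [lambda_0] has degree less than [tau].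
    Such a [w] exists because the number of coefficients of the [lambda_i]
    exceeds the number of linear conditions on them: since the Weierstrass
    semigroup generated by [q] and [q + 1] has [g] gaps, there are at least
    [D + 1 - g] monomials of degree at most [D], and the comparison of the two
    numbers is exactly [tau > tau_max].  The existence of a nonzero kernel
    vector is the pigeonhole principle over the finite field. *)
Require Import Defs.
From mathcomp Require Import all_boot all_order all_algebra all_field.
From mathcomp Require Import zify ring lra.
Import Order.TTheory GRing.Theory Num.Theory.
Local Open Scope ring_scope.
Set Implicit Arguments.
Unset Strict Implicit.
Unset Printing Implicit Defensive.

(** * Canonical representatives and congruence modulo the curve equation *)

Section HermitianRing.

Variables (F : fieldType) (q : nat).
Hypothesis q_gt1 : (1 < q)%N.
Implicit Types (a b p : bipoly F) (P : {poly F}).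

Local Notation H := (hermEq F q).
Local Notation eqR := (eqR q).
Local Notation redH := (redH q).

Lemma hermEqE : H = 'X^q + ('X - ('X ^+ q.+1 : {poly F})%:P).
Proof. by rewrite /hermEq addrA. Qed.

Lemma size_hermEq : size H = q.+1.
Proof. by rewrite hermEqE size_polyDl ?size_polyXn // size_XsubC. Qed.

Lemma hermEq_monic : H \is monic.
Proof.
rewrite hermEqE monicE lead_coefDl ?lead_coefXn //.
by rewrite size_polyXn size_XsubC.
Qed.

Lemma lead_hermEq_unit : lead_coef H \is a GRing.unit.
Proof. by rewrite (monicP hermEq_monic) unitr1. Qed.
Local Notation uH := lead_hermEq_unit.

Lemma size_redH p : (size (redH p) <= q)%N.
Proof. by rewrite -ltnS -size_hermEq ltn_modp monic_neq0 ?hermEq_monic. Qed.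

Lemma redH_id p : (size p <= q)%N -> redH p = p.
Proof. by move=> sp; rewrite /redH modp_small // size_hermEq ltnS. Qed.

Lemma redHK p : redH (redH p) = redH p.
Proof. exact/redH_id/size_redH. Qed.

Lemma redHD a b : redH (a + b) = redH a + redH b.
Proof. exact: (Pdiv.IdomainUnit.modpD uH). Qed.

Lemma redHN a : redH (- a) = - redH a.
Proof. exact: (Pdiv.IdomainUnit.modpN uH). Qed.

Lemma redHB a b : redH (a - b) = redH a - redH b.
Proof. by rewrite redHD redHN. Qed.

Lemma redH0 : redH 0 = 0 :> bipoly F.
Proof. exact: mod0p. Qed.

Lemma redH_sum I r (S : pred I) (f : I -> bipoly F) :
  redH (\sum_(i <- r | S i) f i) = \sum_(i <- r | S i) redH (f i).
Proof. by elim/big_rec2: _ => [|i y x _ <-]; rewrite ?redH0 ?redHD. Qed.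

Lemma redHMC a P : redH (a * P%:P) = redH a * P%:P.
Proof. by rewrite ![_ * P%:P]mulrC !mul_polyC; exact: (Pdiv.IdomainUnit.modpZl uH). Qed.

Lemma coef_redH_ge p j : (q <= j)%N -> (redH p)`_j = 0.
Proof. by move=> qj; rewrite nth_default // (leq_trans (size_redH p)). Qed.

(** Since [hermEq] is monic in Y, Euclidean division by it works over F[X], so remainders are
    canonical representatives. *)
Lemma eqRE a b : eqR a b <-> redH a = redH b.
Proof.
split=> [[c ab] | ab].
  apply/subr0_eq; rewrite -redHB ab /redH.
  by rewrite -[c * H]addr0 (Pdiv.IdomainUnit.modp_addl_mul_small uH) // size_poly0 size_hermEq.
exists ((a - b) %/ H); rewrite [LHS](Pdiv.IdomainUnit.divp_eq uH (a - b)).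
by rewrite -[_ %% _]/(redH (a - b)) redHB ab subrr addr0.
Qed.

Lemma eqRxx a : eqR a a.
Proof. exact/eqRE. Qed.

Lemma eqR_redH a : eqR (redH a) a.
Proof. by apply/eqRE; rewrite redHK. Qed.

Lemma eqR_sym a b : eqR a b -> eqR b a.
Proof. by move/eqRE => ab; apply/eqRE. Qed.

Lemma eqR_trans b a c : eqR a b -> eqR b c -> eqR a c.
Proof. by move=> /eqRE ab /eqRE bc; apply/eqRE; rewrite ab. Qed.

Lemma eqRD a b c d : eqR a b -> eqR c d -> eqR (a + c) (b + d).
Proof. by move=> /eqRE ab /eqRE cd; apply/eqRE; rewrite !redHD ab cd. Qed.

Lemma eqRM a b c d : eqR a b -> eqR c d -> eqR (a * c) (b * d).
Proof.
move=> [x abx] [y cdy]; exists (x * c + b * y).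
have -> : a * c - b * d = (a - b) * c + b * (c - d).
  by rewrite mulrBl mulrBr addrA subrK.
by rewrite abx cdy mulrDl -mulrA [H * c]mulrC !mulrA.
Qed.

Lemma eqRM2l c a b : eqR a b -> eqR (c * a) (c * b).
Proof. exact/eqRM/eqRxx. Qed.

Lemma eqRM2r c a b : eqR a b -> eqR (a * c) (b * c).
Proof. by move=> ab; apply: eqRM => //; apply: eqRxx. Qed.

Lemma eqR_sum I r (S : pred I) (f g : I -> bipoly F) :
  (forall i, S i -> eqR (f i) (g i)) ->
  eqR (\sum_(i <- r | S i) f i) (\sum_(i <- r | S i) g i).
Proof.
by move=> fg; elim/big_rec2: _ => [|i y x Si yx]; [apply: eqRxx | apply/eqRD/yx/fg].
Qed.

Lemma eqR_mulCI P a b : P != 0 -> eqR (a * P%:P) (b * P%:P) -> eqR a b.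
Proof.
move=> P0 /eqRE; rewrite !redHMC => ab; apply/eqRE.
by apply: (mulIf _ ab); rewrite polyC_eq0.
Qed.

(** The ring is free over F[X] on 1, Y, ..., Y^(q-1), so divisibility by a polynomial in X is tested
    coordinate by coordinate. *)
Lemma dvdRP P p :
  reflect (exists c, redH p = redH c * P%:P) [forall j : 'I_q, P %| (redH p)`_j].
Proof.
apply: (iffP forallP) => [dv | [c ->] j]; last by rewrite coefMC dvdp_mull.
exists (map_poly (fun c => c %/ P) (redH p)).
rewrite [redH (map_poly _ _)]redH_id ?(leq_trans (size_poly _ _)) ?size_redH //.
apply/polyP => j; rewrite coefMC coef_map_id0 ?div0p //.
have [jq|qj] := ltnP j q; last by rewrite coef_redH_ge // div0p mul0r.
by rewrite divpK // (dv (Ordinal jq)).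
Qed.

(** * Evaluation and order of vanishing at affine points *)

Lemma evalHM pt a b : evalH pt (a * b) = evalH pt a * evalH pt b.
Proof. by rewrite /evalH !hornerM. Qed.

Lemma evalHD pt a b : evalH pt (a + b) = evalH pt a + evalH pt b.
Proof. by rewrite /evalH !hornerD. Qed.

Lemma evalHB pt a b : evalH pt (a - b) = evalH pt a - evalH pt b.
Proof. by rewrite /evalH !hornerE. Qed.

Lemma evalHC pt P : evalH pt P%:P = P.[pt.1].
Proof. by rewrite /evalH hornerC. Qed.

Lemma evalHX pt p n : evalH pt (p ^+ n) = evalH pt p ^+ n.
Proof. by rewrite /evalH !horner_exp. Qed.

Definition on_curve (pt : F * F) := pt.2 ^+ q + pt.2 == pt.1 ^+ q.+1.

Lemma evalH_eqR pt a b : on_curve pt -> eqR a b -> evalH pt a = evalH pt b.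
Proof.
move=> /eqP onP [c ab]; apply/subr0_eq; rewrite -evalHB ab evalHM.
suff -> : evalH pt H = 0 by rewrite mulr0.
by rewrite /evalH /hermEq !hornerE onP subrr.
Qed.

(** Divisibility by (X - a)^m in the local ring at the point, with the denominator [u] cleared. With
    X - a a uniformizer, this says that the valuation of [p] is at least m. *)
Definition locdiv (pt : F * F) m p := exists u c : bipoly F,
  evalH pt u != 0 /\ eqR (u * p) (c * (('X - pt.1%:P) ^+ m)%:P).

Lemma locdivM pt m n a b : locdiv pt m a -> locdiv pt n b -> locdiv pt (m + n) (a * b).
Proof.
move=> [u [c [u0 uc]]] [v [d [v0 vd]]]; exists (u * v), (c * d).
rewrite evalHM mulf_neq0 // exprD polyCM; split=> //.
by rewrite mulrACA [c * d * _]mulrACA; apply: eqRM.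
Qed.

Lemma locdiv0 pt p : locdiv pt 0 p.
Proof.
exists 1, p; split; first by rewrite /evalH !hornerE oner_neq0.
by rewrite expr0 mul1r mulr1; apply: eqRxx.
Qed.

Lemma locdivX pt m p n : locdiv pt m p -> locdiv pt (n * m) (p ^+ n).
Proof.
move=> dp; elim: n => [|n IHn]; first exact: locdiv0.
by rewrite exprS mulSn; apply: locdivM.
Qed.

Lemma locdiv_prod pt (I : finType) (m : I -> nat) (p : I -> bipoly F) :
  (forall i, locdiv pt (m i) (p i)) -> locdiv pt (\sum_i m i) (\prod_i p i).
Proof.
move=> dp; elim/big_rec2: _ => [|i x y _ yx]; first exact: locdiv0.
exact: locdivM.
Qed.

Lemma locdiv_le pt m n p : (m <= n)%N -> locdiv pt n p -> locdiv pt m p.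
Proof.
move=> mn [u [c [u0 uc]]]; exists u, (c * (('X - pt.1%:P) ^+ (n - m))%:P); split=> //.
by rewrite -mulrA -polyCM -exprD subnK.
Qed.

Hypothesis q_eq0 : q%:R = 0 :> F.

(* As [Y^q - b^q = (Y - b) S] with [S(b) = q b^(q-1) = 0], the function [S + 1]
   is a unit at the point, so that [X - a] is a uniformizer there. *)
Lemma Y_in_locdiv pt : on_curve pt -> exists u w,
  evalH pt u != 0 /\ eqR (u * ('X - pt.2%:P%:P)) (w * ('X - pt.1%:P)%:P).
Proof.
move=> onP.
pose S : bipoly F := \sum_(i < q) 'X ^+ (q.-1 - i) * pt.2%:P%:P ^+ i.
pose T : {poly F} := \sum_(i < q.+1) 'X ^+ (q.+1.-1 - i) * pt.1%:P ^+ i.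
exists (S + 1), (T%:P); split.
  rewrite evalHD; suff -> : evalH pt S = 0.
    by rewrite add0r /evalH !hornerE oner_neq0.
  rewrite /evalH /S !horner_sum.
  rewrite (eq_bigr (fun _ => pt.2 ^+ q.-1)) => [|i _].
    by rewrite sumr_const card_ord -mulr_natl q_eq0 mul0r.
  rewrite !hornerE -exprD subnK //; move: (ltn_ord i); lia.
(* On the curve, (S + 1)(Y - b) = Y^q + Y - b^q - b = X^(q+1) - a^(q+1) = T (X - a); the difference
   of the two ends is [hermEq] itself, hence the witness 1. *)
exists 1; rewrite mul1r mulrDl mul1r [S * _]mulrC -subrXX -polyCM [T * _]mulrC -subrXX.
move/eqP: onP => onP; rewrite /hermEq polyCB !polyC_exp -!polyC_exp -onP.
rewrite !rmorphD /= !polyC_exp; ring.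
Qed.

(** Multiplying by u^m turns each generator (X - a)^k (Y - b)^(m-k) of the m-th power of the maximal
    ideal into u^k w^(m-k) (X - a)^m, because u (Y - b) is congruent to w (X - a). *)
Lemma vge_locdiv pt m p : on_curve pt -> vge q pt m p -> locdiv pt m p.
Proof.
move=> onP [v [v0 [c [d E]]]]; have [u [w [u0 uw]]] := Y_in_locdiv onP.
exists (u ^+ m * v), (\sum_(k < m.+1) c k * u ^+ k * w ^+ (m - k)); split.
  by rewrite evalHM evalHX mulf_neq0 ?expf_neq0.
rewrite -mulrA E mulrDr; apply: (eqR_trans (b := u ^+ m * (\sum_(k < m.+1)
   c k * (('X - pt.1%:P) : {poly F})%:P ^+ k * ('X - pt.2%:P%:P) ^+ (m - k)))).
  by exists (u ^+ m * d); rewrite [LHS]addrC addKr mulrA.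
rewrite mulr_sumr mulr_suml; apply: eqR_sum => k _.
have km : (k <= m)%N by rewrite -ltnS.
have uwX n : eqR ((u * ('X - pt.2%:P%:P)) ^+ n) ((w * ('X - pt.1%:P)%:P) ^+ n).
  by elim: n => [|n IHn]; rewrite ?expr0 ?exprS; [apply: eqRxx | apply: eqRM].
have := eqRM2l (c k * u ^+ k * (('X - pt.1%:P) : {poly F})%:P ^+ k) (uwX (m - k)%N).
have expm (r : bipoly F) : r ^+ m = r ^+ (m - k) * r ^+ k by rewrite -exprD subnK.
rewrite !exprMn polyC_exp (expm u) (expm (_%:P)).
set x := _%:P; set y := 'X - _; set U := u ^+ _; set V := u ^+ _.
rewrite [X in eqR X _ -> _](_ : _ = V * U * (c k * x ^+ k * y ^+ (m - k))); last by ring.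
rewrite [X in eqR _ X -> _](_ : _ =
  c k * U * w ^+ (m - k) * (x ^+ (m - k) * x ^+ k)) //; ring.
Qed.

(** Two applications of the factor theorem write p as (Y - b) g + (X - a) r, and u turns Y - b into
    a multiple of X - a. *)
Lemma root_locdiv pt p : on_curve pt -> evalH pt p = 0 -> locdiv pt 1 p.
Proof.
move=> onP p0; have [u [w [u0 uw]]] := Y_in_locdiv onP.
have /factor_theorem[g Eg] : root (p - p.[pt.2%:P]%:P) pt.2%:P.
  by rewrite rootE !hornerE subrr.
have /factor_theorem[r Er] : root p.[pt.2%:P] pt.1 by apply/eqP.
exists u, (g * w + u * r%:P); split=> //.
rewrite -(subrK p.[pt.2%:P]%:P p) Eg Er mulrDr polyCM mulrCA mulrDl !mulrA expr1.
apply: eqRD; last exact: eqRxx.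
by rewrite -!mulrA; apply: eqRM2l.
Qed.

Lemma evalH_map x y p : evalH (x, y) p = (map_poly (horner_eval x) p).[y].
Proof.
have <- : horner_eval x y%:P = y by rewrite /horner_eval hornerC.
by rewrite horner_map /= /evalH /horner_eval hornerC.
Qed.

(** Induction on m. Setting X = x in the reduced form gives a polynomial in Y of degree below q that
    vanishes at the q points of the fibre, hence is zero. So X - x divides p, and the quotient
    satisfies the hypothesis with m lowered by one. *)
Lemma locdiv_fibre x (ys : seq F) m p :
  uniq ys -> size ys = q -> all (fun y => on_curve (x, y)) ys ->
  (forall y, y \in ys -> locdiv (x, y) m p) ->
  exists c, eqR p (c * (('X - x%:P) ^+ m)%:P).
Proof.
move=> uys sys /allP ons; elim: m p => [|m IHm] p dp.
  by exists p; rewrite expr0 mulr1; apply: eqRxx.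
have p0 : map_poly (horner_eval x) (redH p) = 0.
  apply/eqP/negPn/negP => np0.
  suff /max_poly_roots-/(_ np0 uys) : all (root (map_poly (horner_eval x) (redH p))) ys.
    rewrite sys ltnNge => /negP; apply.
    exact: leq_trans (size_poly _ _) (size_redH _).
  apply/allP => y yin; rewrite rootE -evalH_map.
  rewrite (evalH_eqR (ons _ yin) (eqR_redH p)).
  have [u [c [u0 /(evalH_eqR (ons _ yin))]]] := dp _ yin.
  rewrite !evalHM evalHC horner_exp !hornerE subrr exprS mul0r mulr0 => /eqP.
  by rewrite mulf_eq0 (negPf u0).
have [|c Ec] := @dvdRP ('X - x%:P) p _.
  apply/forallP => j; rewrite dvdp_XsubCl rootE.
  have := congr1 (fun r : {poly F} => r`_j) p0.
  by rewrite coef_map /= coef0 /horner_eval => ->.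
have {}Ec : eqR p (c * ('X - x%:P)%:P) by apply/eqRE; rewrite redHMC.
have [|d Ed] := IHm c.
  move=> y yin; have [u [w [u0 uw]]] := dp _ yin; exists u, w; split=> //.
  apply: (@eqR_mulCI ('X - x%:P)); first by rewrite polyXsubC_eq0.
  rewrite -mulrA -[_ * _ * _]mulrA -polyCM -exprSr.
  by apply: eqR_trans uw; apply/eqRM2l/eqR_sym.
exists d; apply: (eqR_trans Ec).
by rewrite exprSr polyCM mulrA; apply: eqRM2r.
Qed.

(** * Weighted degrees and pole orders at infinity *)

Definition wle (d : nat) (p : bipoly F) :=
  forall i j, p`_j`_i != 0 -> (i * q + j * q.+1 <= d)%N.

Lemma degLeP p d : degLe q p d <-> wle d (redH p).
Proof.
split=> [[-> | dp] i j | wp].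
- by rewrite !coef0 eqxx.
- move=> nz; apply: leq_trans dp; rewrite /degH.
  have jlt : (j < size (redH p))%N.
    by rewrite ltnNge; apply: contra nz => /(nth_default 0) ->; rewrite coef0.
  have ilt : (i < size (rowH q p j))%N.
    by rewrite ltnNge; apply: contra nz => /(nth_default 0) ->.
  apply: leq_trans (leq_bigmax (Ordinal jlt)) => /=.
  exact: (leq_bigmax_cond (Ordinal ilt)).
right; apply/bigmax_leqP => j _; apply/bigmax_leqP => i.
exact: wp.
Qed.

Lemma wle_leq d d' p : (d <= d')%N -> wle d p -> wle d' p.
Proof. by move=> dd' wp i j /wp/leq_trans; apply. Qed.

Lemma wle0 d : wle d 0.
Proof. by move=> i j; rewrite !coef0 eqxx. Qed.

Lemma wleD d a b : wle d a -> wle d b -> wle d (a + b).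
Proof.
move=> wa wb i j; rewrite !coefD.
by have [->|/wa ? _ //] := eqVneq a`_j`_i 0; rewrite add0r => /wb.
Qed.

Lemma wleN d a : wle d a -> wle d (- a).
Proof. by move=> wa i j; rewrite !coefN oppr_eq0 => /wa. Qed.

Lemma wle_sum d I r (S : pred I) (f : I -> bipoly F) :
  (forall i, S i -> wle d (f i)) -> wle d (\sum_(i <- r | S i) f i).
Proof.
by move=> wf; elim/big_rec: _ => [|i x /wf]; [apply: wle0 | apply: wleD].
Qed.

Lemma wleM d d' a b : wle d a -> wle d' b -> wle (d + d') (a * b).
Proof.
move=> wa wb i j; rewrite coefM coef_sum => /eqP nz.
have [k ak] : exists k : 'I_j.+1, (a`_k * b`_(j - k))`_i != 0.
  apply/existsP; apply: contraT; rewrite negb_exists => /forallP z.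
  by case: nz; apply: big1 => k _; apply/eqP/negPn.
rewrite coefM in ak; move/eqP: ak => nz'.
have [l] : exists l : 'I_i.+1, a`_k`_l * b`_(j - k)`_(i - l) != 0.
  apply/existsP; apply: contraT; rewrite negb_exists => /forallP z.
  by case: nz'; apply: big1 => l _; apply/eqP/negPn.
rewrite mulf_eq0 negb_or => /andP[/wa wal /wb wbl].
apply: leq_trans (leq_add wal wbl).
by rewrite addnACA -!mulnDl !subnKC // -ltnS.
Qed.

(* Reduction replaces [Y^q] by [X^(q+1) - Y], which has no larger weight. *)
Lemma wle_redH d p : wle d p -> wle d (redH p).
Proof.
have mono n : forall P : {poly F}, wle d (P%:P * 'X^n) -> wle d (redH (P%:P * 'X^n)).
  elim/ltn_ind: n => n IHn P wP.
  have [nq|qn] := ltnP n q.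
    by rewrite redH_id // mul_polyC (leq_trans (size_scale_leq _ _)) // size_polyXn.
  have coefMX (R : {poly F}) m k : (R%:P * 'X^m)`_k = if k == m then R else 0.
    by rewrite coefCM coefXn; case: eqP; rewrite ?mulr1 ?mulr0.
  have {}wP i : P`_i != 0 -> (i * q + n * q.+1 <= d)%N.
    by move=> Pi; apply: wP; rewrite coefMX eqxx.
  have -> : redH (P%:P * 'X^n) =
      redH ((P * 'X^(q.+1))%:P * 'X^(n - q)) - redH (P%:P * 'X^((n - q).+1)).
    rewrite -redHB; apply/eqRE; exists (P%:P * 'X^(n - q)).
    rewrite /hermEq -{1}(subnK qn) exprD (exprS _ (n - q)) polyCM.
    by set z := polyC ('X^_); ring.
  apply: wleD; last apply: wleN.
    apply: IHn; first by lia.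
    move=> i k; rewrite coefMX; case: (k =P _) => [->|_]; last by rewrite coef0 eqxx.
    rewrite coefMXn; case: ltnP => [_|qi]; first by rewrite eqxx.
    by move/wP; nia.
  apply: IHn; first by lia.
  move=> i k; rewrite coefMX; case: (k =P _) => [->|_]; last by rewrite coef0 eqxx.
  by move/wP; nia.
move=> wp; rewrite -[p]coefK poly_def redH_sum; apply: wle_sum => j _.
rewrite -mul_polyC; apply: mono => i k.
rewrite coefCM coefXn; case: (k =P _) => [->|_]; last by rewrite mulr0 coef0 eqxx.
by rewrite mulr1; apply: wp.
Qed.

Lemma degLe_eqR d a b : eqR a b -> degLe q a d -> degLe q b d.
Proof. by move=> /eqRE ab /degLeP; rewrite ab => /degLeP. Qed.

Lemma degLe_leq d d' p : (d <= d')%N -> degLe q p d -> degLe q p d'.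
Proof. by move=> dd' /degLeP wp; apply/degLeP/(wle_leq dd'). Qed.

(** Reduction raises no weight, so a bound checked on any representative, reduced or not, bounds the
    pole order. *)
Lemma wle_degLe d p : wle d p -> degLe q p d.
Proof. by move=> wp; apply/degLeP/wle_redH. Qed.

Lemma degLeM d d' a b : degLe q a d -> degLe q b d' -> degLe q (a * b) (d + d').
Proof.
move=> /degLeP wa /degLeP wb; apply: (@degLe_eqR _ (redH a * redH b)).
  by apply: eqRM; apply: eqR_redH.
exact/wle_degLe/wleM.
Qed.

Lemma degLe_sum d I r (S : pred I) (f : I -> bipoly F) :
  (forall i, S i -> degLe q (f i) d) -> degLe q (\sum_(i <- r | S i) f i) d.
Proof.
move=> df; apply/degLeP; rewrite redH_sum; apply: wle_sum => i Si.
exact/degLeP/df.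
Qed.

Lemma degLeD d a b : degLe q a d -> degLe q b d -> degLe q (a + b) d.
Proof.
by move=> /degLeP wa /degLeP wb; apply/degLeP; rewrite redHD; apply/wleD.
Qed.

Lemma degLeB d a b : degLe q a d -> degLe q b d -> degLe q (a - b) d.
Proof.
by move=> /degLeP wa /degLeP wb; apply/degLeP; rewrite redHB; apply/wleD/wleN.
Qed.

Lemma degLeC P n : (size P <= n.+1)%N -> degLe q P%:P (n * q).
Proof.
move=> sP; apply: wle_degLe => i j; rewrite coefC.
case: (j =P _) => [->|_]; last by rewrite coef0 eqxx.
rewrite mul0n addn0 leq_mul2r => Pi; apply/orP; right.
by rewrite -ltnS (leq_trans _ sP) // ltnNge; apply: contra Pi => /(nth_default 0) ->.
Qed.

Lemma degLe1 : degLe q (1 : bipoly F) 0.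
Proof. by have := @degLeC 1 0; rewrite size_poly1; apply. Qed.

Lemma degLeX d p n : degLe q p d -> degLe q (p ^+ n) (n * d).
Proof.
move=> dp; elim: n => [|n IHn]; first exact: degLe1.
by rewrite exprS mulSn; apply: degLeM.
Qed.

Lemma degLe_prod (I : finType) (d : I -> nat) (p : I -> bipoly F) :
  (forall i, degLe q (p i) (d i)) -> degLe q (\prod_i p i) (\sum_i d i).
Proof.
move=> dp; elim/big_rec2: _ => [|i x y _ yx]; first exact: degLe1.
exact: degLeM.
Qed.

(** Multiplying by [P] raises the X-degree of every nonzero Y-coefficient by exactly n, so it is
    enough to test the leading monomial of each of these coefficients. *)
Lemma degLe_mulCI d n p P :
  size P = n.+1 -> degLe q (p * P%:P) (d + n * q) -> degLe q p d.
Proof.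
move=> sP /degLeP; rewrite redHMC => wp; apply/degLeP => i j nz.
have p0 : (redH p)`_j != 0 by apply: contraNneq nz => ->; rewrite coef0.
have P0 : P != 0 by rewrite -size_poly_eq0 sP.
have := wp (size ((redH p)`_j * P)%R).-1 j; rewrite coefMC -lead_coefE lead_coef_eq0.
rewrite mulf_neq0 // => /(_ isT); rewrite size_mul // sP.
have: (i < size ((redH p)`_j)%R)%N.
  by rewrite ltnNge; apply: contra nz => /(nth_default 0) ->.
case: (size _) => // k ik; rewrite addSn addnS /= mulnDl.
by have := leq_mul ik (leqnn q); lia.
Qed.

Lemma size_Gfactor : size ('X ^+ (q ^ 2) - 'X : {poly F}) = (q ^ 2).+1.
Proof.
rewrite size_polyDl ?size_polyXn // size_polyN size_polyX.
by rewrite ltnS expnS expn1; nia.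
Qed.

Lemma degLe_G : degLe q (Gpoly F q) (q ^ 3).
Proof.
rewrite /Gpoly (_ : q ^ 3 = q ^ 2 * q)%N; last by rewrite expnSr.
by apply: degLeC; rewrite size_Gfactor.
Qed.

Lemma size_Gfactor_exp m : size (('X ^+ (q ^ 2) - 'X : {poly F}) ^+ m) = (m * q ^ 2).+1.
Proof.
have G0 : 'X ^+ (q ^ 2) - 'X != 0 :> {poly F} by rewrite -size_poly_eq0 size_Gfactor.
have := size_exp ('X ^+ (q ^ 2) - 'X : {poly F}) m; rewrite size_Gfactor /= mulnC => <-.
by rewrite prednK // lt0n size_poly_eq0 expf_neq0.
Qed.

Lemma Gpoly_exp m : Gpoly F q ^+ m = (('X ^+ (q ^ 2) - 'X) ^+ m)%:P.
Proof. by rewrite /Gpoly polyC_exp. Qed.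

Lemma Gpoly_exp_neq0 m : ('X ^+ (q ^ 2) - 'X) ^+ m != 0 :> {poly F}.
Proof. by rewrite -size_poly_eq0 size_Gfactor_exp. Qed.

End HermitianRing.

Lemma prime_power_card (F : finFieldType) (q : nat) :
  (exists p k : nat, [/\ prime p, (0 < k)%N & q = (p ^ k)%N]) -> #|F| = (q ^ 2)%N ->
  (1 < q)%N /\ q%:R = 0 :> F.
Proof.
move=> [p [k [p_pr k0 ->]]] cF; split.
  by rewrite -(exp1n k) ltn_exp2r // prime_gt1.
have pF : p \in [pchar F] by apply: (card_finPcharP (n := k * 2)); rewrite ?expnM.
by rewrite natrX -(prednK k0) exprS pcharf0 // mul0r.
Qed.

Lemma dvdp_prod_XsubC_exp (F : fieldType) (rs : seq F) m (p : {poly F}) :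
  uniq rs -> (forall x, x \in rs -> ('X - x%:P) ^+ m %| p) ->
  (\prod_(x <- rs) ('X - x%:P)) ^+ m %| p.
Proof.
elim: rs => [|x rs IH] /=; first by rewrite big_nil expr1n dvd1p.
move=> /andP[xrs urs] dv; rewrite big_cons exprMn Gauss_dvdp.
  rewrite dv ?mem_head // IH // => y yrs; apply: dv.
  by rewrite in_cons yrs orbT.
apply/coprimep_expl/coprimep_expr; rewrite coprimep_sym coprimep_XsubC.
by rewrite root_prod_XsubC.
Qed.

(** * Fibres of the projection to X, and divisibility by powers of G *)

Section RationalPoints.

Variables (F : finFieldType) (q : nat).
Hypotheses (q_gt1 : (1 < q)%N) (q_eq0 : q%:R = 0 :> F) (cardF : #|F| = (q ^ 2)%N).
Variable pts : 'I_(q ^ 3) -> F * F.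
Hypothesis pts_on : forall k, on_curve q (pts k).
Hypothesis pts_inj : injective pts.
Hypothesis pts_all : forall P, on_curve q P -> exists k, pts k = P.

Lemma card_fibre_le (x : F) : (#|[set y | on_curve q (x, y)]| <= q)%N.
Proof.
pose P : {poly F} := 'X ^+ q + ('X - (x ^+ q.+1)%:P).
have sP : size P = q.+1 by rewrite size_polyDl ?size_polyXn // size_XsubC.
have P0 : P != 0 by rewrite -size_poly_eq0 sP.
rewrite -ltnS -sP cardE; apply: max_poly_roots P0 _ (enum_uniq _).
apply/allP => y; rewrite mem_enum inE /on_curve /= => /eqP e.
by rewrite rootE /P !(hornerD, hornerN, hornerXn, hornerX, hornerC) addrA e subrr.
Qed.

(** Each of the q^2 fibres has at most q points and together they contain the q^3 distinct points
    [pts k], so no fibre can fall short. *)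
Lemma card_fibre (x : F) : #|[set y | on_curve q (x, y)]| = q.
Proof.
apply/eqP; rewrite eqn_leq card_fibre_le leqNgt; apply/negP => ltq.
have : (q ^ 3 <= \sum_(z : F) #|[set y | on_curve q (z, y)]|)%N.
  rewrite -[X in (X <= _)%N]card_ord -(card_codom pts_inj).
  under eq_bigr => z _ do rewrite -sum1_card.
  rewrite (pair_big_dep predT (fun z y => y \in [set y | on_curve q (z, y)])) /=.
  rewrite sum1_card; apply/subset_leq_card/subsetP => _ /codomP[k ->].
  by rewrite unfold_in /= [_ (pts k).2]in_set -surjective_pairing.
rewrite leqNgt (bigD1 x) //=; case/negP.
have le : (\sum_(z | z != x) #|[set y | on_curve q (z, y)]| <= \sum_(z | z != x) q)%N.
  by apply: leq_sum => z _; apply: card_fibre_le.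
rewrite sum_nat_const cardC1 cardF in le.
have q2 : (0 < q ^ 2)%N by rewrite expn_gt0 ltnW.
have -> : (q ^ 3 = q + (q ^ 2).-1 * q)%N by rewrite -mulSn prednK // -expnSr.
by rewrite -addSn leq_add.
Qed.

(** G is the product of X - x over all x in F. The fibre over x yields the factor (X - x)^m, and
    these factors are pairwise coprime. *)
Lemma dvd_Gpoly m p : (forall k, locdiv q (pts k) m p) ->
  exists c, eqR q p (c * Gpoly F q ^+ m).
Proof.
move=> dp; have [|c Ec] := @dvdRP F q q_gt1 (('X ^+ (q ^ 2) - 'X) ^+ m) p _; last first.
  by exists c; apply/(eqRE q_gt1); rewrite Gpoly_exp redHMC.
apply/forallP => j; rewrite -cardF finField_genPoly -big_enum.
apply: dvdp_prod_XsubC_exp; first exact: enum_uniq.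
move=> x _; have [||||c Ec] := @locdiv_fibre F q q_gt1 x (enum [set y | on_curve q (x, y)]) m p.
- exact: enum_uniq.
- by rewrite -cardE card_fibre.
- by apply/allP => y; rewrite mem_enum inE.
- by move=> y; rewrite mem_enum inE => /pts_all[k <-].
by move/(eqRE q_gt1): Ec; rewrite redHMC // => ->; rewrite coefMC dvdp_mull.
Qed.

End RationalPoints.

(** * Multinomial expansion and averages over the simplex of multi-indices *)

Section MultiIndices.

Variables h l : nat.
Implicit Types i j : midx h l.

(** The one-variable binomial formulas are multiplied out; an index not below j contributes a
    vanishing binomial coefficient. *)
Lemma multi_exprDn (A : comNzRingType) (a b : 'I_h -> A) j :
  \prod_mu (a mu + b mu) ^+ j mu =
  \sum_(i | mle i j) (mbinom i j)%:R * (\prod_mu a mu ^+ (j mu - i mu))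
                     * \prod_mu b mu ^+ i mu.
Proof.
pose t mu (k : 'I_l.+1) := 'C(j mu, k)%:R * a mu ^+ (j mu - k) * b mu ^+ k.
transitivity (\prod_mu \sum_k t mu k).
  apply: eq_bigr => mu _; rewrite exprDn.
  rewrite (big_ord_widen l.+1 (fun k => a mu ^+ (j mu - k) * b mu ^+ k *+ 'C(j mu, k))) //.
  rewrite [RHS](bigID (fun k : 'I_l.+1 => (k < (j mu).+1)%N)) /= [X in _ = _ + X]big1 ?addr0.
    by apply: eq_bigr => k _; rewrite /t -mulr_natl mulrA.
  by move=> k; rewrite -leqNgt => jk; rewrite /t bin_small // !mul0r.
rewrite bigA_distr_bigA (bigID (fun i => mle i j)) /= [X in _ + X]big1 ?addr0.
  by apply: eq_bigr => i _; rewrite /mbinom natr_prod -!big_split.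
move=> i; rewrite negb_forall => /existsP[mu]; rewrite -ltnNge => jmu.
by rewrite (bigD1 mu) //= /t bin_small // !mul0r.
Qed.

Lemma mnorm_mle i j : mle i j ->
  mnorm j = (\sum_mu (j mu - i mu) + mnorm i)%N.
Proof.
move/forallP => ij; rewrite /mnorm -big_split /=.
by apply: eq_bigr => mu _; rewrite subnK.
Qed.

Lemma mnorm0 : mnorm (mzero h l) = 0%N.
Proof. by rewrite /mnorm big1 // => mu _; rewrite ffunE. Qed.

Lemma mnorm_eq0 j : mnorm j = 0%N -> j = mzero h l.
Proof.
move/eqP; rewrite /mnorm sum_nat_eq0 => /forallP j0.
by apply/ffunP => mu; rewrite ffunE; apply/val_inj/eqP/j0.
Qed.

(** On the simplex this is an involution exchanging the coordinate [mu] with the slack; [inord]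
    loses nothing, as the slack is at most l. *)
Definition slack_swap mu j : midx h l :=
  [ffun nu => if nu == mu then inord (l - mnorm j) else j nu].

Lemma mnorm_slack_swap mu j : (mnorm j <= l)%N ->
  mnorm (slack_swap mu j) = (l - j mu)%N.
Proof.
move=> jl; rewrite /mnorm (bigD1 mu) //= ffunE eqxx inordK ?ltnS ?leq_subr //.
rewrite (eq_bigr (fun nu => j nu : nat)); last first.
  by move=> nu /negPf ne; rewrite ffunE ne.
move: jl; rewrite /mnorm (bigD1 mu) //=; move: (leq_ord (j mu)); lia.
Qed.

Lemma slack_swapK mu j : (mnorm j <= l)%N -> slack_swap mu (slack_swap mu j) = j.
Proof.
move=> jl; apply/ffunP => nu; rewrite ffunE mnorm_slack_swap //.
rewrite subKn ?leq_ord // inord_val; case: eqP => [->//|/eqP/negPf ne].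
by rewrite ffunE ne.
Qed.

(* The [h] coordinates and the slack [l - mnorm j] play symmetric roles on the
   simplex, hence have the same average. *)
Lemma sum_mnorm_le :
  (h.+1 * \sum_(j : midx h l | (mnorm j <= l)%N) mnorm j = h * l * Cle h l)%N.
Proof.
set W := (\sum_(j | _) _)%N.
have swap mu : (\sum_(j : midx h l | (mnorm j <= l)%N) j mu =
                \sum_(j : midx h l | (mnorm j <= l)%N) (l - mnorm j))%N.
  rewrite [RHS](reindex_onto (slack_swap mu) (slack_swap mu)); last first.
    exact: slack_swapK.
  apply: eq_big => [j | j jl]; last first.
    by rewrite mnorm_slack_swap // subKn // leq_ord.
  apply/idP/andP => [jl | [jl /eqP <-]].
    by rewrite mnorm_slack_swap // leq_subr slack_swapK.
  by rewrite mnorm_slack_swap // leq_subr.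
have WE : W = (h * \sum_(j : midx h l | (mnorm j <= l)%N) (l - mnorm j))%N.
  rewrite /W exchange_big /= (eq_bigr _ (fun mu _ => swap mu)).
  by rewrite sum_nat_const card_ord.
have : (\sum_(j : midx h l | (mnorm j <= l)%N) (l - mnorm j) + W = l * Cle h l)%N.
  rewrite /W -big_split /= (eq_bigr (fun _ => l)) => [|j jl]; last by rewrite subnK.
  by rewrite sum_nat_cond_const mulnC /Cle cardsE.
by rewrite -mulnA => <-; rewrite mulSn mulnDr -WE addnC.
Qed.

End MultiIndices.

(** Makes the truncated subtraction in [2 * genus q - 1] an honest one. *)
Lemma genus_gt0 q : (1 < q)%N -> (0 < genus q)%N.
Proof. by move=> q1; rewrite /genus half_gt0; nia. Qed.

(** * Counting monomials by weight: the semigroup generated by q and q + 1 *)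

Section MonomialCount.

Variable q : nat.
Hypothesis q_gt0 : (0 < q)%N.

Definition wt (t : nat * nat) : nat := t.1 * q + t.2 * q.+1.
Definition wtI B (t : 'I_B * 'I_q) : nat := wt (val t.1, val t.2).

Lemma wtE a b : wt (a, b) = ((a + b) * q + b)%N.
Proof. by rewrite /wt mulnS mulnDl addnA addnAC. Qed.

(** The weight modulo q is the Y-exponent b, because b < q; the X-exponent is then determined. *)
Lemma wtI_inj B : injective (@wtI B).
Proof.
move=> [a b] [a' b']; rewrite /wtI /= => e.
have eb : b = b'.
  apply: val_inj; rewrite /= -(modn_small (ltn_ord b)) -(modn_small (ltn_ord b')).
  by move/(congr1 (modn^~ q)): e; rewrite !wtE !modnMDl.
subst b'; congr pair; apply: val_inj => /=.
by move: e; rewrite /wt /= => /addIn => /eqP; rewrite eqn_pmul2r // => /eqP.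
Qed.

Lemma card_wt_interval B lo hi :
  (#|[set t : 'I_B * 'I_q | lo < wtI t <= hi]| <= hi - lo)%N.
Proof.
rewrite cardE -(size_map (@wtI B)) -(size_iota lo.+1 (hi - lo)).
apply: uniq_leq_size; first by rewrite map_inj_uniq ?enum_uniq //; apply: wtI_inj.
move=> _ /mapP[t + ->]; rewrite mem_enum inE mem_iota; lia.
Qed.

(** A pair a < b < q encodes the gap a q + b of the semigroup. *)
Lemma card_gaps : #|[set t : 'I_q * 'I_q | (t.1 < t.2)%N]| = genus q.
Proof.
rewrite /genus subn1 -bin2 -bin2_sum big_mkord -sum1_card.
under eq_bigl => t do rewrite inE.
rewrite -(pair_big_dep predT (fun a b : 'I_q => (a < b)%N) (fun _ _ => 1%N)) /=.
rewrite (exchange_big_dep predT) //=; apply: eq_bigr => b _.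
by rewrite -(big_ord_widen _ (fun _ => 1%N)) ?sum_nat_const ?card_ord ?muln1 // ltnW.
Qed.

(** Write d <= D as a q + b with b < q. If b <= a, then d is the weight of X^(a-b) Y^b; otherwise it
    is one of the gaps. The bound on D keeps the X-exponent below [B]. *)
Lemma card_wt_le B D : (D < B * q)%N ->
  (D.+1 <= #|[set t : 'I_B * 'I_q | wtI t <= D]| + genus q)%N.
Proof.
move=> DB; rewrite -card_gaps !cardE -(size_map (@wtI B)).
rewrite -(size_map (fun t : 'I_q * 'I_q => (t.1 * q + t.2)%N) (enum [set t | _])) -size_cat.
rewrite -[X in (X <= _)%N](size_iota 0); apply: uniq_leq_size; first exact: iota_uniq.
move=> d; rewrite mem_iota add0n /= ltnS mem_cat => dD; have := divn_eq d q.
have := ltn_pmod d q_gt0; set b := (d %% q)%N; set a := (d %/ q)%N => bq de.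
have [ba|ab] := leqP b a; apply/orP; [left|right].
  have aB : (a - b < B)%N.
    by rewrite (leq_ltn_trans (leq_subr _ _)) // -(ltn_pmul2r q_gt0); lia.
  apply/mapP; exists (Ordinal aB, Ordinal bq); last first.
    by rewrite /wtI wtE /= subnK.
  by rewrite mem_enum inE /wtI wtE /= subnK // -de.
apply/mapP; exists (Ordinal (ltn_trans ab bq), Ordinal bq) => //.
by rewrite mem_enum inE.
Qed.

End MonomialCount.

(** Functions equal to [r0] off [A] number |R|^|A|, while the values of [Phi] on [K] take at most
    |R|^|K| forms. No linearity is required here. *)
Lemma pigeonhole_supported (R : finType) (r0 : R) (T T' : finType)
    (A : {set T}) (K : {set T'}) (Phi : {ffun T -> R} -> T' -> R) :
  (1 < #|R|)%N -> (#|K| < #|A|)%N ->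
  exists x y : {ffun T -> R},
    [/\ x != y, forall t, t \notin A -> x t = y t &
        forall t, t \in K -> Phi x t = Phi y t].
Proof.
move=> R1 KA; pose D := [pred x | x \in pffun_on r0 (mem A) (mem R)].
pose g (x : {ffun T -> R}) := [ffun t => if t \in K then Phi x t else r0].
have /dinjectivePn[x Dx [y /andP[yx Dy] gxy]] : ~~ dinjectiveb g D.
  apply/dinjectiveP => /card_in_image e.
  have : (#|image g D| <= #|pffun_on r0 (mem K) (mem R)|)%N.
    apply/subset_leq_card/subsetP => _ /imageP[x _ ->]; apply/pffun_onP.
    split=> [|//]; apply/supportP => t tK.
    by rewrite ffunE (negPf tK).
  rewrite e !card_pffun_on leqNgt => /negP; apply.
  by rewrite ltn_exp2l.
exists x, y; split=> [|t tA|t tK].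
- by rewrite eq_sym.
- have supp (z : {ffun T -> R}) : z \in D -> z t = r0.
    by move=> /pffun_onP[/supportP/(_ t tA)].
  by rewrite !supp.
by move/ffunP/(_ t): gxy; rewrite !ffunE tK.
Qed.

Lemma card_fibred (I T : finType) (P : I -> T -> bool) :
  #|[set p : I * T | P p.1 p.2]| = (\sum_i #|[set t | P i t]|)%N.
Proof.
rewrite -sum1_card; under eq_bigl => p do rewrite inE.
rewrite -(pair_big_dep predT P (fun _ _ => 1%N)) /=; apply: eq_bigr => i _.
by rewrite -sum1_card; apply: eq_bigl => t; rewrite inE.
Qed.

(** * The linear map sending the lambda_i to the psi_j *)

Section Rows.

Variables (F : fieldType) (q : nat).
Hypothesis q_gt1 : (1 < q)%N.
Variables (h l s : nat) (Rv : 'I_h -> bipoly F).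
Implicit Types (lam : midx h l -> bipoly F) (i j : midx h l).

Local Notation Gs := (('X ^+ (q ^ 2) - 'X) ^+ s : {poly F}).

Lemma rowsumD lam lam' j :
  rowsum q s Rv (fun i => lam i + lam' i) j = rowsum q s Rv lam j + rowsum q s Rv lam' j.
Proof. by rewrite /rowsum -big_split; apply: eq_bigr => i _; rewrite mulrDl. Qed.

Lemma rowsumB lam lam' j :
  rowsum q s Rv (fun i => lam i - lam' i) j = rowsum q s Rv lam j - rowsum q s Rv lam' j.
Proof. by rewrite /rowsum -sumrB; apply: eq_bigr => i _; rewrite mulrBl. Qed.

(** Only i = 0 lies below the index 0. That index, which is outside the set of the psi_j, can thus
    carry a condition on lambda_0. *)
Lemma rowsum_mzero lam : (0 < s)%N -> rowsum q s Rv lam (mzero h l) = lam (mzero h l).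
Proof.
move=> s0; rewrite /rowsum (bigD1 (mzero h l)) ?mnorm0 //= big1 ?addr0 => [|i].
  rewrite /Aij ifT; last by apply/forallP.
  rewrite mnorm0 /mbinom !big1 ?mulr1 // => mu _; last by rewrite ffunE.
  by rewrite subnn.
case/andP=> _ i0; rewrite /Aij ifF ?mulr0 //; apply: contraNF i0.
move/forallP => i0; apply/eqP/mnorm_eq0; rewrite /mnorm big1 // => mu _.
by apply/eqP; rewrite -leqn0; have := i0 mu; rewrite ffunE.
Qed.

(* The candidate for [psi_j]: for [|j| >= s], the residue modulo [G^s] involving
   only the [s q^3] monomials [X^a Y^b] with [a < s q^2]. *)
Definition row_rep lam j : bipoly F :=
  let S := redH q (rowsum q s Rv lam j) in
  if (mnorm j < s)%N then S else map_poly (fun c => c %% Gs) S.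

(** Additivity turns a collision between two families into vanishing coefficients for their
    difference. *)
Lemma row_repB lam lam' j :
  row_rep (fun i => lam i - lam' i) j = row_rep lam j - row_rep lam' j.
Proof.
rewrite /row_rep rowsumB redHB //; case: ifP => // _.
apply/polyP => k; rewrite coefB !coef_map_id0 ?mod0p //.
by rewrite coefB modpD modpN.
Qed.

Lemma row_rep_lt lam j : (mnorm j < s)%N ->
  eqR q (row_rep lam j) (rowsum q s Rv lam j).
Proof. by move=> js; rewrite /row_rep js; apply: eqR_redH. Qed.

Lemma row_rep_ge lam j : (s <= mnorm j)%N ->
  exists c, eqR q (row_rep lam j - rowsum q s Rv lam j) (c * Gpoly F q ^+ s).
Proof.
move=> js; rewrite /row_rep ltnNge js /=; set S := rowsum _ _ _ _ _.
exists (- map_poly (fun c => c %/ Gs) (redH q S)); apply: (eqR_trans q_gt1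
  (b := map_poly (fun c => c %% Gs) (redH q S) - redH q S)).
  by apply/(eqRE q_gt1); rewrite !redHB // redHK.
rewrite Gpoly_exp (_ : _ - _ = - map_poly (fun c => c %/ Gs) (redH q S) * Gs%:P).
  exact: eqRxx.
apply/polyP => k; rewrite coefB coefMC coefN !coef_map_id0 ?mod0p ?div0p //.
by rewrite {2}(divp_eq (redH q S)`_k Gs) mulNr opprD addrCA subrr addr0.
Qed.

Lemma coef_row_rep_ge lam j a b : (s <= mnorm j)%N ->
  (row_rep lam j)`_b`_a != 0 -> (a < s * q ^ 2)%N /\ (b < q)%N.
Proof.
move=> js; rewrite /row_rep ltnNge js /= coef_map_id0 ?mod0p // => nz; split.
  rewrite -ltnS -(size_Gfactor_exp F q_gt1 s).
  apply: leq_ltn_trans (ltn_modpN0 ((redH q (rowsum q s Rv lam j))`_b) (Gpoly_exp_neq0 F q_gt1 s)).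
  by rewrite ltnNge; apply: contra nz => /(nth_default 0) ->.
rewrite ltnNge; apply: contra nz => qb.
by rewrite coef_redH_ge // mod0p coef0.
Qed.

(** The parameter [g] will be twice the genus. With n = q^3, the term i is bounded by d + |i|(g - 1)
    + (|j| - |i|)(n + g - 1) + |i| n, in which |i| cancels. *)
Lemma degLe_rowsum lam j d g :
  (0 < g)%N ->
  (forall mu, degLe q (Rv mu) (q ^ 3 + g).-1) ->
  (forall i, (mnorm i < s)%N -> degLe q (lam i) (d + mnorm i * (g - 1))) ->
  degLe q (rowsum q s Rv lam j) (d + mnorm j * (q ^ 3 + g - 1)).
Proof.
move=> g0 dR dlam; apply: degLe_sum => // i si; rewrite /Aij.
case: ifP => [ij|_]; last first.
  by rewrite mulr0; left; rewrite redH0.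
have dA : degLe q ((mbinom i j)%:R * \prod_mu Rv mu ^+ (j mu - i mu) * Gpoly F q ^+ mnorm i)
   (0 * q + \sum_mu (j mu - i mu) * (q ^ 3 + g).-1 + mnorm i * q ^ 3).
  apply/degLeM/degLeX/degLe_G => //; apply: degLeM => //.
    rewrite -polyC_natr; apply: degLeC => //.
    by rewrite -polyC_natr size_polyC leq_b1.
  by apply: degLe_prod => // mu; apply: degLeX.
apply: degLe_leq _ (degLeM q_gt1 (dlam i si) dA).
rewrite (mnorm_mle ij) -big_distrl /= mul0n add0n; set m := (\sum_mu _)%N.
by rewrite -addnA leq_add2l mulnDl; have := leqnn (mnorm i); nia.
Qed.

End Rows.

Lemma monicH_addl (F : fieldType) q (p w : bipoly F) : (1 < q)%N ->
  monicH q p -> (forall i j, (redH q w)`_j`_i != 0 -> (wt q (i, j) < degH q p)%N) ->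
  monicH q (p + w) /\ degH q (p + w) = degH q p.
Proof.
move=> q1 [i0 [j0 [top wtop]]] lt_w.
have w0 : (redH q w)`_j0`_i0 = 0.
  by apply: contraTeq isT => /lt_w; rewrite /wt /= wtop ltnn.
have top' : (redH q (p + w))`_j0`_i0 = 1 by rewrite redHD // !coefD top w0 addr0.
have e : degH q (p + w) = degH q p.
  apply/eqP; rewrite eqn_leq; apply/andP; split; last first.
    have /(degLeP q _ _)/(_ i0 j0) : degLe q (p + w) (degH q (p + w)) by right.
    by rewrite top' oner_neq0 wtop; apply.
  have [|//] : degLe q (p + w) (degH q p).
    apply: degLeD => //; first by right.
    by apply/degLeP => i j /lt_w/ltnW.
  by move/(congr1 (fun r : bipoly F => r`_j0`_i0)); rewrite top' !coef0 => /eqP; rewrite oner_eq0.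
by split=> //; exists i0, j0; rewrite e.
Qed.

(** * The explicit solution built from the error locator *)

Section FirstSolution.

Variables (F : finFieldType) (q : nat).
Hypotheses (q_gt1 : (1 < q)%N) (q_eq0 : q%:R = 0 :> F) (cardF : #|F| = (q ^ 2)%N).
Variable pts : 'I_(q ^ 3) -> F * F.
Hypothesis pts_on : forall k, on_curve q (pts k).
Hypothesis pts_inj : injective pts.
Hypothesis pts_all : forall P, on_curve q P -> exists k, pts k = P.
Variables (h l s mH : nat) (f Rv : 'I_h -> bipoly F) (bad : pred 'I_(q ^ 3)).
Variable Lam : bipoly F.
Hypothesis s_gt0 : (0 < s)%N.
Hypothesis mH_lt : (mH < q ^ 3)%N.
Hypothesis degf : forall mu, degLe q (f mu) mH.
Hypothesis degR : forall mu, degLe q (Rv mu) (q ^ 3 + 2 * genus q).-1.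
Hypothesis agree : forall mu k, ~~ bad k -> evalH (pts k) (Rv mu) = evalH (pts k) (f mu).
Hypothesis LamV : forall k, bad k -> vge q (pts k) s Lam.
Hypothesis LamM : monicH q Lam.

Lemma first_solution : exists lam psi : midx h l -> bipoly F,
  isSolution q s mH Rv lam psi /\ degH q (lam (mzero h l)) = degH q Lam.
Proof.
pose D i : bipoly F := \prod_mu (f mu - Rv mu) ^+ (i : midx h l) mu.
have /fin_all_exists[lam Elam] : forall i, exists c,
    eqR q (Lam * D i) (c * Gpoly F q ^+ minn s (mnorm i)).
  move=> i; apply: (dvd_Gpoly q_gt1 cardF pts_on pts_inj pts_all) => k.
  (* At an error point [Lam] supplies order s; elsewhere each factor f - R vanishes, so the product
     has order |i|. The minimum serves both cases. *)
  have [bk|gk] := boolP (bad k).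
    rewrite -[minn _ _]addn0; apply: locdivM; last exact: (locdiv0 q_gt1).
    exact/(locdiv_le (geq_minl _ _))/(vge_locdiv q_gt1 q_eq0)/LamV.
  rewrite -[minn _ _]add0n; apply: locdivM; first exact: (locdiv0 q_gt1).
  apply: (locdiv_le (geq_minr _ _)); apply: (locdiv_prod q_gt1) => mu.
  rewrite -[X in locdiv _ _ X](muln1 (i mu)); apply/(locdivX q_gt1)/(root_locdiv q_gt1 q_eq0) => //.
  by rewrite evalHB agree // subrr.
(* At index 0 both the power of G and the product [D] are 1, so lambda_0 is [Lam]. *)
have e0 : redH q (lam (mzero h l)) = redH q Lam.
  apply/esym/(eqRE q_gt1); have := Elam (mzero h l).
  rewrite mnorm0 minn0 expr0 mulr1 /D big1 ?mulr1 // => mu _.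
  by rewrite ffunE.
have d0 : degH q (lam (mzero h l)) = degH q Lam by rewrite /degH /rowH /coefH e0.
have expand j : eqR q (Lam * \prod_mu f mu ^+ (j : midx h l) mu) (rowsum q s Rv lam j +
    (\sum_(i | mle i j && (s <= mnorm i)%N)
       (mbinom i j)%:R * (\prod_mu Rv mu ^+ (j mu - i mu)) * lam i) * Gpoly F q ^+ s).
  rewrite (eq_bigr (fun mu => (Rv mu + (f mu - Rv mu)) ^+ j mu)); last first.
    by move=> mu _; rewrite addrC subrK.
  (* The terms with |i| < s carry G^|i| and rebuild [rowsum]; each remaining term carries the full
     G^s. *)
  rewrite multi_exprDn mulr_sumr mulr_suml (bigID (fun i => (mnorm i < s)%N)) /=.
  apply: (eqRD q_gt1).
    rewrite /rowsum big_mkcondl /=; apply: (eqR_sum q_gt1) => i si.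
    rewrite /Aij; case: ifP => _; last by rewrite mulr0; apply: (eqRxx q_gt1).
    have := eqRM2l q_gt1 ((mbinom i j)%:R * \prod_mu Rv mu ^+ (j mu - i mu)) (Elam i).
    by rewrite (minn_idPr (ltnW si)) mulrCA mulrCA [X in eqR _ _ X]mulrCA.
  rewrite (eq_bigl (fun i => mle i j && (s <= mnorm i)%N)); last first.
    by move=> i; rewrite -leqNgt.
  apply: (eqR_sum q_gt1) => i /andP[_ si].
  have := eqRM2l q_gt1 ((mbinom i j)%:R * \prod_mu Rv mu ^+ (j mu - i mu)) (Elam i).
  by rewrite (minn_idPl si) mulrCA [X in eqR _ _ X]mulrA.
exists lam, (fun j : midx h l => Lam * \prod_mu f mu ^+ j mu); split=> //; split.
- case: LamM => i [j [top wtop]]; exists i, j; by rewrite e0 d0.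
(* For |j| < s no index below j has norm at least s, so the multiple of G^s is absent and the
   congruence is an equality. *)
- move=> j _ js; have := expand j; rewrite [\sum_(_ | _ && _) _]big_pred0 ?mul0r ?addr0 // => i.
  apply/negP => /andP[/mnorm_mle e si]; move: js; rewrite e ltnNge => /negP; apply.
  exact: leq_trans si (leq_addl _ _).
- move=> j _ js; eexists; apply: (eqR_trans q_gt1
    (b := _ + _ - rowsum q s Rv lam j)).
    by apply: (eqRD q_gt1); [exact: expand | exact: (eqRxx q_gt1)].
  by rewrite addrAC subrr add0r; apply: (eqRxx q_gt1).
- move=> i si; rewrite d0.
  (* Cancelling G^|i|, of degree |i| n, from a product whose factors f - R have degree at most n +
     2g - 1 leaves |i|(2g - 1). *)
  apply: (degLe_mulCI q_gt1 (size_Gfactor_exp F q_gt1 (mnorm i))).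
  rewrite -Gpoly_exp; apply: (degLe_eqR q_gt1 (a := Lam * D i)).
    by have := Elam i; rewrite (minn_idPr (ltnW si)).
  have dD : degLe q (D i) (\sum_mu i mu * (q ^ 3 + 2 * genus q).-1).
    apply: degLe_prod => // mu; apply: degLeX => //; apply: degLeB => //.
    by apply: degLe_leq (degf mu); lia.
  have dL : degLe q Lam (degH q Lam) by right.
  apply: degLe_leq (degLeM q_gt1 dL dD).
  rewrite -big_distrl /= -/(mnorm i) -addnA leq_add2l -mulnA -expnSr -mulnDr leq_mul2l.
  by apply/orP; right; have := genus_gt0 q_gt1; lia.
move=> j _; rewrite d0; apply: degLeM => //; first by right.
rewrite /mnorm big_distrl /=; apply: degLe_prod => // mu.
exact: degLeX.
Qed.

End FirstSolution.

(** * Families of ring elements encoded by finite coefficient vectors *)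

Section CoefficientFunctions.

Variables (F : fieldType) (q B : nat) (J : finType).
Implicit Types (x : {ffun J * ('I_B * 'I_q) -> F}).

Definition poly_of_coefs x (i : J) : bipoly F :=
  \sum_(t : 'I_B * 'I_q) (x (i, t) *: 'X^(t.1))%:P * 'X^(t.2).

Lemma coef_poly_of_coefs x i a b : (poly_of_coefs x i)`_b`_a =
  \sum_(t : 'I_B * 'I_q | (a == t.1 :> nat) && (b == t.2 :> nat)) x (i, t).
Proof.
rewrite coef_sum coef_sum [RHS]big_mkcond; apply: eq_bigr => t _.
rewrite coefCM coefXn; have [_|_] := eqVneq b (t.2 : nat); last by rewrite mulr0 coef0 andbF.
by rewrite mulr1 coefZ coefXn andbT; case: eqP; rewrite ?mulr1 ?mulr0.
Qed.

Lemma coef_poly_of_coefs_ord x i (t : 'I_B * 'I_q) :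
  (poly_of_coefs x i)`_(t.2)`_(t.1) = x (i, t).
Proof.
rewrite coef_poly_of_coefs (big_pred1 t) // => -[a b]; case: t => a' b' /=.
by rewrite [RHS]eq_sym.
Qed.

Lemma poly_of_coefsB_neq0 x y i a b : (poly_of_coefs x i - poly_of_coefs y i)`_b`_a != 0 ->
  exists2 t : 'I_B * 'I_q, x (i, t) != y (i, t) & a = t.1 /\ b = t.2.
Proof.
rewrite !coefB !coef_poly_of_coefs -sumrB => nz.
have [t /andP[/andP[/eqP-> /eqP->] xy]] : exists t : 'I_B * 'I_q,
    ((a == t.1 :> nat) && (b == t.2 :> nat)) && (x (i, t) - y (i, t) != 0).
  apply/existsP; apply: contraNT nz; rewrite negb_exists => /forallP z.
  rewrite big1 // => t tab; have := z t; rewrite tab /= negbK => /eqP //.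
by exists t => //; rewrite -subr_eq0.
Qed.

Lemma redH_poly_of_coefsB x y i : (1 < q)%N ->
  redH q (poly_of_coefs x i - poly_of_coefs y i) = poly_of_coefs x i - poly_of_coefs y i.
Proof.
move=> q1; apply: redH_id => //; apply/leq_sizeP => b qb; apply/polyP => a.
rewrite coef0; apply/eqP; apply: contraLR qb => /poly_of_coefsB_neq0[t _ [_ ->]].
by rewrite -ltnNge.
Qed.

End CoefficientFunctions.

(** * Comparison of the numbers of unknowns and of linear conditions *)

Section Counting.

Variables (q h l s mH tau B : nat).
Hypotheses (q_gt1 : (1 < q)%N) (s_gt0 : (0 < s)%N) (s_le : (s <= l)%N).
Hypothesis mH_lt : (mH < q ^ 3)%N.
Hypothesis tau_lt : (tau + l * mH < s * q ^ 3)%N.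
Hypothesis B_large : (tau + (s + l) * (q ^ 3 + 2 * genus q) + s * q ^ 2 < B)%N.

Local Notation n := (q ^ 3)%N.
Local Notation g := (genus q).
Local Notation idx := (midx h l).
Local Notation mon := ('I_B * 'I_q)%type.

Definition unknown (i : idx) (t : mon) :=
  (mnorm i < s)%N && (wtI t <= tau + mnorm i * (2 * g - 1))%N.

(** The coefficients forced to vanish. At j = 0: weight tau in lambda_0, so that adding the family
    keeps [Lam] leading. For 0 < |j| < s: weights between the allowed bound and the a priori bound
    on [rowsum]. For |j| >= s: excessive weights among the monomials of a residue modulo G^s. *)
Definition constraint (j : idx) (t : mon) :=
  if mnorm j == 0%N then wtI t == tau
  else if (mnorm j < s)%N then (tau + mnorm j * mH < wtI t <= tau + mnorm j * (n + 2 * g - 1))%N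
  else [&& (mnorm j <= l)%N, (tau + mnorm j * mH < wtI t)%N & (t.1 < s * q ^ 2)%N].

Definition Cge := #|[set j : idx | (s <= mnorm j <= l)%N]|.
Definition Wge := (\sum_(j : idx | (s <= mnorm j <= l)%N) mnorm j)%N.

Let q_gt0 : (0 < q)%N := ltnW q_gt1.

Lemma CltE : Clt h l s = (\sum_(j : idx | (mnorm j < s)%N) 1)%N.
Proof. by rewrite sum1_card /Clt cardsE. Qed.

Lemma CgeE : Cge = (\sum_(j : idx | (s <= mnorm j <= l)%N) 1)%N.
Proof. by rewrite sum1_card /Cge cardsE. Qed.

Lemma sum_mnorm_split (f : idx -> nat) :
  (\sum_(j | (mnorm j <= l)%N) f j =
   \sum_(j | (mnorm j < s)%N) f j + \sum_(j | (s <= mnorm j <= l)%N) f j)%N.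
Proof.
rewrite (bigID (fun j => (mnorm j < s)%N)) /=; congr addn; apply: eq_bigl => j.
  by move: s_le; lia.
by rewrite -leqNgt andbC.
Qed.

Lemma Cle_split : Cle h l = (Clt h l s + Cge)%N.
Proof. by rewrite CltE CgeE -sum_mnorm_split sum1_card /Cle cardsE. Qed.

Lemma card_unknowns :
  (tau.+1 * Clt h l s + (2 * g - 1) * Wlt h l s <=
   #|[set p : idx * mon | unknown p.1 p.2]| + g * Clt h l s)%N.
Proof.
rewrite card_fibred (bigID (fun i => (mnorm i < s)%N)) /= -addnA.
apply: leq_trans (leq_add (leqnn _) (leq_addl _ _)).
rewrite CltE /Wlt !big_distrr -!big_split /=; apply: leq_sum => i si.
rewrite /unknown si /=; rewrite !muln1 addSn [((2 * g - 1) * _)%N]mulnC.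
apply: card_wt_le => //; apply: (leq_trans _ (leq_pmulr _ q_gt0)).
apply: leq_ltn_trans B_large; rewrite -addnA leq_add2l.
have : (mnorm i * (2 * g - 1) <= s * (n + 2 * g))%N by apply: leq_mul; lia.
by rewrite mulnDl; lia.
Qed.

Lemma card_lt_X N : (N <= B)%N -> #|[set t : mon | (t.1 < N)%N]| = (N * q)%N.
Proof.
move=> NB; have -> : [set t : mon | (t.1 < N)%N] = setX [set a : 'I_B | (a < N)%N] setT.
  by apply/setP => t; rewrite !inE andbT.
rewrite cardsX cardsT card_ord; congr muln; rewrite -sum1_card.
under eq_bigl => a do rewrite inE.
by rewrite -(big_ord_widen _ (fun _ => 1%N)) // sum_nat_const card_ord muln1.
Qed.

(** A residue modulo G^s has s n monomials. Since tau + |j| mH < s n, every monomial of weight at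
    most tau + |j| mH is among them, and there are at least tau + |j| mH + 1 - g of these; only the
    others are constrained. *)
Lemma card_constraint_ge (j : idx) : (s <= mnorm j <= l)%N ->
  (#|[set t : mon | constraint j t]| + (tau.+1 + mH * mnorm j) <= s * n + g)%N.
Proof.
move=> /andP[sj jl]; have lo_lt : (tau + mnorm j * mH < s * n)%N.
  by apply: leq_ltn_trans tau_lt; rewrite leq_add2l leq_mul2r jl orbT.
have sB : (s * q ^ 2 <= B)%N by move: B_large; lia.
have := @card_wt_le q q_gt0 B (tau + mnorm j * mH).
have DB : (tau + mnorm j * mH < B * q)%N.
  by apply: leq_trans lo_lt _; rewrite expnSr mulnA leq_mul2r sB orbT.
move=> /(_ DB); set S := [set t | _]; set K := [set t | _] => cS.
have : (#|K| + #|S| <= s * n)%N.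
  rewrite expnSr mulnA -(card_lt_X sB) -cardsUI (_ : K :&: S = set0).
    rewrite cards0 addn0; apply/subset_leq_card/subsetP => t; rewrite !inE.
    case/orP => [|tS].
      by rewrite /constraint (gtn_eqF (leq_trans s_gt0 sj)) ltnNge sj /= => /and3P[].
    have : (t.1 * q < s * q ^ 2 * q)%N.
      rewrite -mulnA -expnSr; apply: leq_ltn_trans lo_lt; apply: leq_trans tS.
      by rewrite /wtI /wt leq_addr.
    by rewrite ltn_pmul2r.
  apply/setP => t; rewrite !inE; apply/negP => /andP[].
  rewrite /constraint (gtn_eqF (leq_trans s_gt0 sj)) ltnNge sj /= => /and3P[_ + _].
  by rewrite ltnNge => /negP.
by rewrite [(mH * _)%N]mulnC; lia.
Qed.

Lemma card_constraints :
  (#|[set p : idx * mon | constraint p.1 p.2]| + (tau.+1 * Cge + mH * Wge) <=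
   (Wlt h l s * (n + 2 * g - 1 - mH) + 1) + (s * n + g) * Cge)%N.
Proof.
rewrite card_fibred (bigID (fun j => (mnorm j < s)%N)) /= -addnA; apply: leq_add.
  rewrite (bigD1 (mzero h l)) ?mnorm0 //= addnC; apply: leq_add; last first.
    apply/card_le1_eqP => t t'; rewrite !inE /constraint mnorm0 /= => /eqP e /eqP e'.
    by apply: (wtI_inj q_gt0); rewrite e.
  rewrite /Wlt big_distrl /= [leqRHS](bigD1 (mzero h l)) ?mnorm0 //= mul0n add0n.
  apply: leq_sum => j /andP[js j0]; have nz : (mnorm j == 0%N) = false.
    by apply: contraNF j0 => /eqP/mnorm_eq0 ->.
  rewrite /constraint js nz.
  apply: leq_trans (card_wt_interval q_gt0 _ _ _) _.
  by rewrite subnDl -mulnBr.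
rewrite CgeE /Wge !big_distrr -!big_split /= (bigID (fun j => (mnorm j <= l)%N)) /=.
(* The index type also contains j with |j| > l; they impose no condition. *)
rewrite [X in (_ + X + _)%N]big1 => [|j /andP[js jl]]; last first.
  apply/eqP; rewrite cards_eq0; apply/eqP/setP => t; rewrite !inE /constraint.
  by rewrite (negPf js) (negPf jl) ifF //; apply: contraNF jl => /eqP ->.
rewrite addn0 (eq_bigl (fun j => (s <= mnorm j <= l)%N)); last by move=> j; rewrite -leqNgt.
rewrite -big_split; apply: leq_sum => j sjl; rewrite !muln1.
exact: card_constraint_ge.
Qed.

(** Multiply tau > tau_max by the number of j with |j| <= l: by [sum_mnorm_le] the term with h/(h+1)
    becomes mH times the sum of all |j|. Negative terms change sides to stay in the natural
    numbers. *)
Lemma tau_max_counting : (0 < h)%N ->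
  tau_max h l s n g mH < tau%:R ->
  (1 + s * n * Cge + n * Wlt h l s + g * Cle h l <
   tau.+1 * Cle h l + mH * (Wlt h l s + Wge))%N.
Proof.
move=> h0; have WE := sum_mnorm_le h l.
rewrite sum_mnorm_split -/(Wlt h l s) -/Wge in WE.
have C0 : (0 < Cle h l)%N.
  by rewrite /Cle; apply/card_gt0P; exists (mzero h l); rewrite inE mnorm0.
rewrite /tau_max; move: WE C0; rewrite Cle_split.
set C := Clt h l s; set W := Wlt h l s; set C' := Cge; set W' := Wge.
move=> WE C0; rewrite -(ltr_nat rat) !(natrD, natrM) -!natr1.
have {}WE : (h%:R + 1) * (W%:R + W'%:R) = h%:R * l%:R * (C%:R + C'%:R) :> rat.
  by rewrite natr1 -!(natrD, natrM) WE.
have CC0 : 0 < C%:R + C'%:R :> rat by rewrite -natrD ltr0n.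
have ss : s%:R != 0 :> rat by rewrite pnatr_eq0 -lt0n.
have hh : h%:R + 1 != 0 :> rat by rewrite natr1 pnatr_eq0.
rewrite -(ltr_pM2r CC0); set X := (X in X < _ -> _).
suff -> : X = s%:R * n%:R * (C%:R + C'%:R) - n%:R * (s%:R * C%:R - W%:R)
   - mH%:R * (W%:R + W'%:R) + 1 - (C%:R + C'%:R) + g%:R * (C%:R + C'%:R) by lra.
have -> : W%:R + W'%:R = h%:R * l%:R * (C%:R + C'%:R) / (h%:R + 1) :> rat.
  by rewrite -WE mulrAC divff // mul1r.
rewrite /X; field; rewrite hh ss.
by rewrite (gt_eqF CC0).
Qed.

Lemma constraints_lt_unknowns : (0 < h)%N -> tau_max h l s n g mH < tau%:R ->
  (#|[set p : idx * mon | constraint p.1 p.2]| <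
   #|[set p : idx * mon | unknown p.1 p.2]|)%N.
Proof.
move=> h0 /(tau_max_counting h0) count.
have := card_unknowns; have := card_constraints; move: count; rewrite Cle_split.
set k := #|_|; set u := #|_|; set W := Wlt h l s.
(* Isolates W (2g - 1), which also occurs in the count of unknowns and cancels. *)
have -> : (W * (n + 2 * g - 1 - mH) = W * (2 * g - 1) + W * (n - mH))%N.
  by rewrite -mulnDr; congr muln; have := genus_gt0 q_gt1; lia.
have : (W * (n - mH) + W * mH = W * n)%N by rewrite -mulnDr subnK // ltnW.
rewrite !mulnDr !mulnDl [((2 * g - 1) * W)%N]mulnC [(n * W)%N]mulnC [(mH * W)%N]mulnC.
lia.
Qed.

End Counting.

(** * A nonzero family solving the homogeneous system *)

Section SecondSolution.

Variables (F : finFieldType) (q : nat).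
Hypotheses (q_gt1 : (1 < q)%N) (cardF : #|F| = (q ^ 2)%N).
Variables (h l s mH tau : nat) (Rv : 'I_h -> bipoly F).
Hypotheses (h_gt0 : (0 < h)%N) (s_gt0 : (0 < s)%N) (s_le : (s <= l)%N).
Hypothesis mH_lt : (mH < q ^ 3)%N.
Hypothesis degR : forall mu, degLe q (Rv mu) (q ^ 3 + 2 * genus q).-1.
Hypothesis tau_lt : (tau + l * mH < s * q ^ 3)%N.
Hypothesis tau_gt : tau_max h l s (q ^ 3) (genus q) mH < tau%:R.

Lemma homogeneous_solution : exists w : midx h l -> bipoly F,
  [/\ (exists2 i, (mnorm i < s)%N & redH q (w i) <> 0),
      (forall i j, (redH q (w (mzero h l)))`_j`_i != 0 -> (wt q (i, j) < tau)%N),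
      (forall i, (mnorm i < s)%N -> degLe q (w i) (tau + mnorm i * (2 * genus q - 1))) &
      (forall j, (1 <= mnorm j <= l)%N ->
         degLe q (row_rep q s Rv w j) (tau + mnorm j * mH))].
Proof.
(* Large enough that truncating X-exponents at [B] discards no monomial allowed by the degree bounds
   or by a residue modulo G^s. *)
pose B := (tau + (s + l) * (q ^ 3 + 2 * genus q) + s * q ^ 2).+1.
have q_gt0 := ltnW q_gt1; have g_gt0 := genus_gt0 q_gt1.
pose A := [set p : midx h l * ('I_B * 'I_q) | unknown s tau p.1 p.2].
pose K := [set p : midx h l * ('I_B * 'I_q) | constraint s mH tau p.1 p.2].
have KA : (#|K| < #|A|)%N by apply: constraints_lt_unknowns.
have F1 : (1 < #|F|)%N by rewrite cardF; nia.
pose rep (x : {ffun midx h l * ('I_B * 'I_q) -> F}) := row_rep q s Rv (poly_of_coefs x).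
pose Phi x (p : midx h l * ('I_B * 'I_q)) : F := (rep x p.1)`_(p.2.2)`_(p.2.1).
have [x [y [xy xyA xyK]]] := pigeonhole_supported 0 Phi F1 KA.
pose w i := poly_of_coefs x i - poly_of_coefs y i.
have redw i : redH q (w i) = w i by apply: redH_poly_of_coefsB.
have degw i : (mnorm i < s)%N -> degLe q (w i) (tau + mnorm i * (2 * genus q - 1)).
  move=> si; apply/degLeP; rewrite redw => a b /poly_of_coefsB_neq0[t xyt [-> ->]].
  have : (i, t) \in A by apply: contraNT xyt => /xyA ->.
  by rewrite inE /unknown si.
have wK j (t : 'I_B * 'I_q) : constraint s mH tau j t -> (row_rep q s Rv w j)`_(t.2)`_(t.1) = 0.
  move=> jt; rewrite row_repB // !coefB; apply/eqP; rewrite subr_eq0; apply/eqP.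
  by apply: (xyK (j, t)); rewrite inE.
have inB D a b : (wt q (a, b) <= D)%N -> (D < B)%N -> (a < B)%N.
  by rewrite /wt /=; nia.
exists w; split=> //.
- have [p np] : exists p, x p != y p.
    by apply/existsP; apply: contraNT xy; rewrite negb_exists => /forallP e;
      apply/eqP/ffunP => p; apply/eqP/negPn/e.
  case: p np => i t np; exists i.
    have : (i, t) \in A by apply: contraNT np => /xyA ->.
    by rewrite inE => /andP[].
  rewrite redw => /(congr1 (fun r : bipoly F => r`_(t.2)`_(t.1))).
  by rewrite !coefB !coef_poly_of_coefs_ord !coef0 => /eqP; rewrite subr_eq0 (negPf np).
(* The degree is at most tau by the choice of unknowns, and the coefficient of weight tau is killed
   by the constraint at index 0. *)
- move=> a b nz; have := degw (mzero h l); rewrite mnorm0 => /(_ s_gt0)/degLeP.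
  move=> /(_ a b nz); rewrite mul0n addn0 leq_eqVlt => /predU1P[e|//].
  have [t _ [ea eb]] : exists2 t : 'I_B * 'I_q, x (mzero h l, t) != y (mzero h l, t)
      & a = t.1 /\ b = t.2 by apply: poly_of_coefsB_neq0; rewrite -[_ - _]redw.
  have /wK : constraint s mH tau (mzero h l) t.
    by rewrite /constraint mnorm0 /= /wtI /wt /= -ea -eb e.
  rewrite /row_rep mnorm0 s_gt0 rowsum_mzero // => e0.
  by move: nz; rewrite ea eb e0 eqxx.
move=> j /andP[j0 jl]; have [js|sj] := ltnP (mnorm j) s.
  (* A coefficient above the allowed bound is still within the a priori bound on [rowsum], hence
     sits at a constrained position. *)
  apply/degLeP => a b nz; rewrite leqNgt; apply/negP => lo.
  have : degLe q (row_rep q s Rv w j) (tau + mnorm j * (q ^ 3 + 2 * genus q - 1)).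
    apply: (degLe_eqR q_gt1 (eqR_sym q_gt1 (row_rep_lt q_gt1 Rv w js))).
    by apply: degLe_rowsum => //; lia.
  move/degLeP => /(_ a b nz) hi.
  have aB : (a < B)%N.
    apply: inB hi _; rewrite ltnS -addnA leq_add2l.
    by apply: leq_trans (leq_addr _ _); apply: leq_mul; lia.
  have bq : (b < q)%N.
    by rewrite ltnNge; apply: contra nz => qb; rewrite coef_redH_ge // coef0.
  have := @wK j (Ordinal aB, Ordinal bq); rewrite /constraint js (gtn_eqF j0).
  rewrite /wtI /wt /= lo hi => /(_ isT) e0; move: nz; rewrite /row_rep js redHK //.
  by move: e0; rewrite /row_rep js => ->; rewrite eqxx.
(* Here the a priori bound is on exponents: the residue has X-exponents below s q^2 and Y-exponents
   below q. *)
apply: wle_degLe => // a b nz; rewrite leqNgt; apply/negP => lo.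
have [as2 bq] := coef_row_rep_ge q_gt1 sj nz.
have aB : (a < B)%N by apply: leq_trans as2 _; rewrite /B; lia.
have := @wK j (Ordinal aB, Ordinal bq).
rewrite /constraint (gtn_eqF j0) ltnNge sj jl /wtI /wt /= lo as2 => /(_ isT) e0.
by move: nz; rewrite e0 eqxx.
Qed.

End SecondSolution.

(** * Two distinct solutions: the explicit one and its translate by the homogeneous family *)

Unset Implicit Arguments.

Theorem theorem4
  (F : finFieldType) (q : nat)
  (Hq : exists p k : nat, [/\ prime p, (0 < k)%N & q = (p ^ k)%N])
  (HF : #|F| = (q ^ 2)%N)
  (pts : 'I_(q ^ 3) -> F * F)
  (Hon : forall k, (pts k).2 ^+ q + (pts k).2 = (pts k).1 ^+ q.+1)
  (Hinj : injective pts)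
  (Hall : forall a b : F, b ^+ q + b = a ^+ q.+1 -> exists k, pts k = (a, b))
  (h : nat) (Hh : (1 <= h)%N)
  (mH : nat)
  (HmH1 : 2%:Z * ((genus q)%:Z - 1) < mH%:Z)
  (HmH2 : (mH < q ^ 3)%N)
  (f : 'I_h -> bipoly F) (Hf : forall i, degLe q (f i) mH)
  (e : 'M[F]_(h, q ^ 3))
  (Rv : 'I_h -> bipoly F)
  (HR1 : forall i, degLe q (Rv i) (q ^ 3 + 2 * genus q).-1)
  (HR2 : forall i k, evalH (pts k) (Rv i) = evalH (pts k) (f i) + e i k)
  (s l : nat) (Hs : (1 <= s)%N) (Hsl : (s <= l)%N)
  (Lam : bipoly F)
  (HLv : forall k, [exists i, e i k != 0] -> vge q (pts k) s Lam)
  (HLm : monicH q Lam)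
  (HLmin : forall L : bipoly F,
      (forall k, [exists i, e i k != 0] -> vge q (pts k) s L) ->
      monicH q L -> (degH q Lam <= degH q L)%N)
  (Htau1 : (degH q Lam + l * mH < s * q ^ 3)%N)
  (Htau2 : tau_max h l s (q ^ 3) (genus q) mH < (degH q Lam)%:R) :
  exists lam1 psi1 lam2 psi2 : midx h l -> bipoly F,
    [/\ isSolution q s mH Rv lam1 psi1,
        isSolution q s mH Rv lam2 psi2,
        degH q (lam1 (mzero h l)) = degH q Lam,
        degH q (lam2 (mzero h l)) = degH q Lam &
        (exists i, (mnorm i < s)%N /\ ~ eqR q (lam1 i) (lam2 i)) \/
        (exists j, (1 <= mnorm j <= l)%N /\ ~ eqR q (psi1 j) (psi2 j))].
Proof.
have [q_gt1 q_eq0] := prime_power_card Hq HF.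
have pts_on k : on_curve q (pts k) by apply/eqP.
have pts_all P : on_curve q P -> exists k, pts k = P.
  by case: P => a b /eqP /Hall.
pose bad k := [exists i, e i k != 0].
have agree mu k : ~~ bad k -> evalH (pts k) (Rv mu) = evalH (pts k) (f mu).
  rewrite negb_exists => /forallP/(_ mu)/negPn/eqP e0.
  by rewrite HR2 e0 addr0.
have [lam [psi [sol degl]]] := first_solution q_gt1 q_eq0 HF pts_on Hinj pts_all
  l Hs HmH2 Hf HR1 agree HLv HLm.
have [w [[i si wi] w0 degw degpsi]] := homogeneous_solution q_gt1 HF Hh Hs Hsl HmH2 HR1 Htau1 Htau2.
case: sol => lamM small big dlam dpsi; rewrite degl in dlam dpsi.
have [lamM' degl'] : monicH q (lam (mzero h l) + w (mzero h l)) /\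
    degH q (lam (mzero h l) + w (mzero h l)) = degH q Lam.
  by rewrite -degl; apply: monicH_addl => // a b /w0; rewrite degl.
exists lam, psi, (fun j => lam j + w j), (fun j => psi j + row_rep q s Rv w j).
split=> //.
- by split=> //; rewrite degl.
- split=> //; rewrite ?degl'.
  + move=> j jl js; rewrite rowsumD; apply: (eqRD q_gt1); first exact: small.
    exact: row_rep_lt.
  + move=> j jl js; have [c Ec] := big j jl js; have [d Ed] := row_rep_ge q_gt1 Rv w js.
    exists (c + d); rewrite rowsumD mulrDl opprD addrACA.
    exact: (eqRD q_gt1).
  + by move=> j js; apply: degLeD => //; [exact: dlam | exact: degw].
  + by move=> j jl; apply: degLeD => //; [exact: dpsi | exact: degpsi].
(* The two solutions differ by w_i at this index, and w_i is nonzero in the ring. *)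
left; exists i; split=> // /(eqRE q_gt1); rewrite redHD // => /eqP.
by rewrite -subr_eq0 opprD addNKr oppr_eq0 => /eqP.
Qed.
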